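(* Let $\mathcal{H}=(V,\mathcal{E})$ be a hypergraph with fixed maximum vertex degree $\Delta$ and maximum edge size $\ell$, with $V=\{v_1,\dots,v_n\}$, let $b_1,\dots,b_n\in\mathbb{N}_{\ge 2}$ satisfy $b_i\le d(v_i)-1$ for all $i\in[n]$, and put $b=\min_{i\in[n]}b_i$ and $\delta=\Delta-b+1$. Let $k\in\mathbb{N}_{\ge2}$ be a constant and let $$\epsilon\in\left[\tfrac{\delta-1}{2\delta},\left(\tfrac{\delta-1}{2\delta}\right)^{1/k}\right],\qquad a_{k,\epsilon}=\frac{k(1-\epsilon)+(\delta-1)(1-\epsilon^k)}{2},\qquad \alpha=\frac{(b-1)\delta\epsilon^k}{6\ell}\exp(a_{k,\epsilon}).$$ Then the algorithm SET MULTICOVER (described in the context), run with these parameters, returns a set multicover $C$ such that $$|C|<\max\left\{\left(1-\tfrac12(1-\epsilon)\epsilon^k\right)\delta,\ \left(1-\frac{(b-1)\epsilon^k}{18\ell}\exp(a_{k,\epsilon})\right)\delta\right\}\cdot \mathrm{Opt}^{*}$$ with probability greater than $0.65$, where $\mathrm{Opt}^*$ is the optimal value of the linear programming relaxation of the set multicover problem for $(\mathcal{H},(b_1,\dots,b_n))$.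
   Context: A hypergraph $\mathcal{H}=(V,\mathcal{E})$ consists of a finite set $V=\{v_1,\dots,v_n\}$ of vertices and a family $\mathcal{E}=\{E_1,\dots,E_m\}\subseteq 2^V$ of edges. The degree $d(v)$ of a vertex is the number of edges containing it, $\Delta=\max_v d(v)$; the size of an edge is its number of vertices, and $\ell$ is the maximum edge size. $[n]=\{1,\dots,n\}$. Given $b_1,\dots,b_n$, a vertex $v_i$ is fully covered by $C\subseteq\mathcal{E}$ if it lies in at least $b_i$ edges of $C$; a set multicover is a set $C\subseteq\mathcal{E}$ fully covering every vertex. The set multicover problem is to find a set multicover of minimum cardinality. LP relaxation: minimize $\sum_{j=1}^m x_j$ subject to $\sum_{j:\,v_i\in E_j}x_j\ge b_i$ for all $i\in[n]$ and $x_j\in[0,1]$ for all $j\in[m]$. Its optimal value is $\mathrm{Opt}^*$. Algorithm SET MULTICOVER. Set $\lambda=\frac{\delta+1}{2}$, $\lambda_0=(1-\epsilon)\delta$, and $\alpha$ as in the claim. (1) Start with $C=\emptyset$ and compute an optimal solution $x^*\in[0,1]^m$ of the LP relaxation. (2) Set $C_1=\{E_j: x_j^*\ge \frac1\lambda\}$, $C_2=\{E_j:\frac1\lambda>x_j^*\ge\frac1\delta\}$, $C_3=\{E_j: 0<x_j^*<\frac1\delta\}$. (3) Put all edges of $C_1$ into $C$. (4) If $|C_1|\ge\alpha\cdot\mathrm{Opt}^*$, return $C=C_1\cup C_2$. (5) Otherwise: (a) for each $E_j\in C_2$, independently, perform $k$ independent biased coin flips each showing heads with probability $\lambda_0x_j^*$,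 and include $E_j$ in $C$ if at least one of them shows heads; (b) for each $E_j\in C_3$, independently, include $E_j$ in $C$ with probability $(1-\epsilon^k)\delta x_j^*$; (c) (repairing) if necessary, include in $C$ arbitrary edges from $C_2$ incident to vertices that are not fully covered, until all vertices are fully covered; (d) return $C$. *)

(* Defs.v *)
From HB Require Import structures.
From mathcomp Require Import all_boot all_order all_algebra.
From mathcomp Require Import classical_sets reals sequences exp.

Set Implicit Arguments.
Unset Strict Implicit.
Unset Printing Implicit Defensive.

Import Order.TTheory GRing.Theory Num.Theory.
Local Open Scope ring_scope.

(* A hypergraph on the finite vertex type V is its set E of edges (repeated
   edges are excluded, as E is a subset of the power set of V); b is the demand
   of each vertex. *)
Section Multicover.
Context {V : finType} (E : {set {set V}}) (b : V -> nat).

Definition degree (v : V) : nat := #|[set e in E | v \in e]|.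

Definition max_degree : nat := (\max_(v : V) degree v)%N.

Definition max_edge_size : nat := (\max_(e in E) #|e|)%N.

(* The starting value is an upper bound of all demands, so that this is the
   minimum demand as soon as V is nonempty. *)
Definition min_demand : nat := \big[minn/(\max_(v : V) b v)%N]_(v : V) b v.

Definition delta : nat := (max_degree - min_demand + 1)%N.

Definition fully_covered (C : {set {set V}}) (v : V) : bool :=
  (b v <= #|[set e in C | v \in e]|)%N.

Definition set_multicover (C : {set {set V}}) : bool :=
  (C \subset E) && [forall v, fully_covered C v].

End Multicover.

Section LinearProgram.
Context {R : realType} {V : finType} (E : {set {set V}}) (b : V -> nat).

(* Only the values x e for e \in E matter. *)
Definition lp_value (x : {set V} -> R) : R := \sum_(e in E) x e.

Definition lp_feasible (x : {set V} -> R) : Prop :=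
  (forall v : V, (b v)%:R <= \sum_(e in E | v \in e) x e) /\
  (forall e : {set V}, e \in E -> 0 <= x e <= 1).

Definition lp_opt : R := inf [set lp_value x | x in lp_feasible]%classic.

Definition lp_optimal (x : {set V} -> R) : Prop :=
  lp_feasible x /\ (forall y, lp_feasible y -> lp_value x <= lp_value y).

End LinearProgram.

(* Probability of the event A for a family of independent coins indexed by I,
   the coin i showing heads (true) with probability p i. *)
Definition coins_prob {R : realType} {I : finType} (p : I -> R)
    (A : pred {ffun I -> bool}) : R :=
  \sum_(w | A w) \prod_(i : I) (if w i then p i else 1 - p i).

Section Algorithm.
Context {R : realType} {V : finType} (E : {set {set V}}) (b : V -> nat).
Context (k : nat) (eps : R).

Local Notation dlt := ((delta E b)%:R : R).

Definition lambda : R := (dlt + 1) / 2.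

Definition lambda0 : R := (1 - eps) * dlt.

Definition a_param : R := (k%:R * (1 - eps) + (dlt - 1) * (1 - eps ^+ k)) / 2.

Definition alpha : R :=
  ((min_demand b)%:R - 1) * dlt * eps ^+ k / (6 * (max_edge_size E)%:R)
  * expR a_param.

(* x is the optimal LP solution computed in the first step. *)
Context (x : {set V} -> R).

Definition edges1 : {set {set V}} := [set e in E | lambda^-1 <= x e].

Definition edges2 : {set {set V}} := [set e in E | dlt^-1 <= x e < lambda^-1].

Definition edges3 : {set {set V}} := [set e in E | 0 < x e < dlt^-1].

(* All the coins: k flips inl (e, i) for each e in edges2, and a single one
   inr e for each e in edges3.  The coins of the other edges are never looked
   at, and are given bias 0. *)
Definition coin : finType := ({set V} * 'I_k + {set V})%type.

Definition coin_bias (c : coin) : R :=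
  match c with
  | inl (e, _) => if e \in edges2 then lambda0 * x e else 0
  | inr e => if e \in edges3 then (1 - eps ^+ k) * dlt * x e else 0
  end.

Definition sampled (w : {ffun coin -> bool}) : {set {set V}} :=
  edges1 :|: [set e in edges2 | [exists i : 'I_k, w (inl (e, i))]]
         :|: [set e in edges3 | w (inr e)].

Definition repair_step : rel {set {set V}} := fun C D =>
  [exists e in edges2 :\: C,
    [exists v in e, ~~ fully_covered b C v] && (D == e |: C)].

(* Repairing is nondeterministic: C' is any set in which a maximal sequence of
   repair steps starting from C can end.  That no vertex is left uncovered when
   no step is possible any more is not built into the definition. *)
Definition repaired (C C' : {set {set V}}) : bool :=
  connect repair_step C C' && [forall D, ~~ repair_step C' D].

(* C is a possible output when the coins show w. *)
Definition output (w : {ffun coin -> bool}) (C : {set {set V}}) : bool :=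
  if alpha * lp_opt E b <= #|edges1|%:R then C == edges1 :|: edges2
  else repaired (sampled w) C.

End Algorithm.

Arguments coin V k : clear implicits.

(* Main.v *)
(* Let Y = delta * Opt, A = eps^k * Y, n = #|V|, let m' be the number of edges
   with x > 0 and D = Y - m'.  Counting the edges above a threshold shows that
   every vertex v lies in at least b_v - 1 edges of C1 and in at least b_v edges
   of C1 and C2 together; hence one repair edge suffices for each uncovered
   vertex, and n (b - 1) <= l |C1|.

   Moving x along x + t h with h = (delta - kappa) x - 1 on the edges with
   0 < x < 1 shows, by optimality, that either D >= (delta - 1) / 2 * Opt, or
   some edge has x = 1 and D >= delta - 1.  This gives the strict inequality when
   the algorithm stops at C1 and C2, and otherwise settles the case
   D > (1 - eps) A / 2 without any probability, as every output has at most m'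
   edges.

   In the remaining case |C1| < alpha * Opt gives 6 n < e^a A, which together
   with (delta - 1) (Opt - n) <= D forces delta >= 4.  A vertex stays uncovered
   with probability at most e^(-2a), so that by Markov's inequality there are at
   least A / 5 repairs with probability at most (5 / 6) e^(-a).  The number U of
   edges of C2 and C3 that are not chosen has mean at least A - D, and a Chernoff
   bound for its lower tail, applied to exp (- 6 U / 5), bounds the probability of
   all other failures by exp (- 2.29). *)
Require Import Defs.
From mathcomp Require Import all_boot all_order all_algebra.
From mathcomp Require Import classical_sets reals sequences exp.
From mathcomp Require Import ring lra zify.
(* classical_sets shadows set0, subsetP, ... on finite sets. *)
Import boot.fintype boot.finset.

Import Order.TTheory GRing.Theory Num.Theory.
Local Open Scope ring_scope.

(** * Real inequalities *)

Section RealInequalities.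
Context {R : realType}.
Implicit Types (eps u : R) (k : nat).

Lemma root_bound k eps u : (0 < k)%N -> 0 <= eps -> 0 <= u ->
  eps <= u `^ (k%:R^-1) -> eps ^+ k <= u.
Proof.
move=> k0 e0 u0 /(lerXn2r k) => /(_ e0 (powR_ge0 _ _)) h.
apply: le_trans h _; rewrite -powR_mulrn ?powR_ge0 // -powRrM mulVf ?powRr1 //.
by rewrite pnatr_eq0 -lt0n.
Qed.

(* Both sides divided by [(1 - u) * (1 - eps)] are geometric sums. *)
Lemma geometric_ratio k eps u : 0 <= u -> u <= eps -> eps <= 1 ->
  (1 - eps) * (1 - u ^+ k) <= (1 - u) * (1 - eps ^+ k).
Proof.
move=> u0 ue e1.
have geomE t : 1 - t ^+ k = (1 - t) * \sum_(i < k) t ^+ i.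
  by rewrite -opprB subrX1 -mulNr opprB.
rewrite !geomE mulrCA ler_wpM2l //; first by lra.
rewrite ler_wpM2l //; first by lra.
by apply: ler_sum => i _; apply: lerXn2r => //; rewrite nnegrE //; lra.
Qed.

Lemma bernoulli_upper k eps : 0 <= eps -> eps <= 1 ->
  1 - eps ^+ k <= k%:R * (1 - eps).
Proof.
move=> e0 e1; rewrite -opprB subrX1 -mulNr opprB mulrC ler_wpM2r //; first by lra.
rewrite -[leRHS]mulr1 mulr_natl -[X in _ *+ X]card_ord -sumr_const.
by apply: ler_sum => i _; apply: exprn_ile1.
Qed.

(** The left side is the [k]-th power of [eps * e^(1 - eps)], which is at most 1 because
    [1 + t <= e^t] at [t = eps - 1]. *)
Lemma expr_expR_le1 k eps : 0 <= eps -> eps ^+ k * expR (k%:R * (1 - eps)) <= 1.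
Proof.
move=> e0; rewrite expRM_natl -exprMn exprn_ile1 //.
  by rewrite mulr_ge0 ?expR_ge0.
have := expR_ge1Dx (eps - 1); have := expRxMexpNx_1 (1 - eps).
have := expR_gt0 (1 - eps); rewrite opprB; nra.
Qed.

Lemma expR_ge_taylor n (v : R) : 0 <= v ->
  \sum_(0 <= i < n) v ^+ i / i`!%:R <= expR v.
Proof.
move=> v0; have := nondecreasing_cvgn_le _ (is_cvg_series_exp_coeff v) n.
apply; apply/nondecreasing_seqP => m.
rewrite /series /= big_nat_recr //= lerDl /exp_coeff /=.
by rewrite divr_ge0 // exprn_ge0.
Qed.

Lemma expR_ge_taylor6 (v : R) : 0 <= v ->
  1 + v + v ^+ 2 / 2 + v ^+ 3 / 6 + v ^+ 4 / 24 + v ^+ 5 / 120 <= expR v.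
Proof.
move=> /(expR_ge_taylor 6); rewrite !big_nat_recr //= big_geq // add0r.
rewrite expr0 expr1 !factS fact0; apply: le_trans; rewrite le_eqVlt; apply/orP; left.
by apply/eqP; field.
Qed.

Lemma expR_5_4_ge : 34 / 10 + 8 / 100 <= expR (5 / 4) :> R.
Proof.
have v0 : 0 <= 5 / 4 :> R by lra.
by have := expR_ge_taylor6 _ v0; lra.
Qed.

Lemma expR_6_5_ge : 33 / 10 + 1 / 100 <= expR (6 / 5) :> R.
Proof.
have v0 : 0 <= 6 / 5 :> R by lra.
by have := expR_ge_taylor6 _ v0; lra.
Qed.

Lemma expR_229_100_ge : 97 / 10 <= expR (229 / 100) :> R.
Proof.
have v0 : 0 <= 229 / 200 :> R by lra.
(* At 2.29 the degree 5 polynomial reaches only about 9.58; at half the argument it exceeds 3.12,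
   and [3.12 ^ 2 > 9.7]. *)
have -> : 229 / 100 = 229 / 200 + 229 / 200 :> R by lra.
have : 312 / 100 <= expR (229 / 200) :> R by have := expR_ge_taylor6 _ v0; lra.
by rewrite expRD; nra.
Qed.

Lemma expRN_229_100_le : expR (- (229 / 100)) <= 104 / 1000 :> R.
Proof.
rewrite expRN (@le_trans _ _ (97 / 10)^-1) //; last by lra.
by rewrite lef_pV2 ?posrE ?expR_gt0 ?expR_229_100_ge //; lra.
Qed.

(** From [1 - t <= e^(-t)] at [t = 1 / 10] follows [e^(1/10) <= 10 / 9], whose tenth power is below
    2.88. *)
Lemma expR1_le : expR 1 <= 288 / 100 :> R.
Proof.
have -> : expR (1 : R) = expR (1 / 10) ^+ 10 by rewrite -expRM_natl; congr expR; lra.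
have t0 := expR_gt0 (1 / 10 : R); set t := expR _ in t0 *.
have t1 : t <= 10 / 9.
  have := expR_ge1Dx (- (1 / 10) : R); have := expRxMexpNx_1 (1 / 10 : R).
  by rewrite -/t; nra.
have t2 : t ^+ 2 <= 1235 / 1000 by rewrite expr2; nra.
have t4 : t ^+ 2 * t ^+ 2 <= 1526 / 1000 by have := exprn_ge0 2 (ltW t0); nra.
have t5 : t ^+ 5 <= 1696 / 1000.
  have -> : t ^+ 5 = t ^+ 2 * t ^+ 2 * t by ring.
  by have := ler_wpM2r (ltW t0) t4; lra.
have -> : t ^+ 10 = t ^+ 5 * t ^+ 5 by ring.
by have := exprn_ge0 5 (ltW t0); move: (t ^+ 5) t5 => q; nra.
Qed.

(* The hypotheses on [opt] force [delta * eps ^+ k * expR a] to exceed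
   [1.5 * (3 + eps)], whereas its square is at most
   [delta ^ 2 * eps ^+ k * expR (delta - 1)]. *)
Lemma small_delta_excluded k (d : nat) eps (n opt : R) :
  let s := eps ^+ k in let D := d%:R in
  let a := (k%:R * (1 - eps) + (D - 1) * (1 - s)) / 2 in
  (2 <= d)%N -> eps <= 1 -> (D - 1) / (2 * D) <= eps -> s <= (D - 1) / (2 * D) ->
  0 < opt -> (D - 1) * (opt - n) <= (1 - eps) * s * (D * opt) / 2 ->
  6 * n < expR a * (s * (D * opt)) -> (4 <= d)%N.
Proof.
move=> s D a d2 eps1 epsge sle opt0 h1 h2.
have [//|d4] := leqP 4 d.
have e0 : 0 <= eps.
  apply: le_trans epsge; rewrite divr_ge0 // ?mulr_ge0 // ?ler0n // subr_ge0.
  by rewrite ler1n; lia.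
have s0 : 0 <= s by apply: exprn_ge0.
(* Squaring doubles the exponent [a], so that one of the two factors [s] is absorbed by
   [e^(k (1 - eps))]. *)
have ea2 : (s * expR a) ^+ 2 <= s * expR ((D - 1) * (1 - s)).
  rewrite exprMn -[expR a ^+ 2]expRM_natl (_ : 2 * a = k%:R * (1 - eps) +
    (D - 1) * (1 - s)); last by rewrite /a; field.
  rewrite expRD expr2 -!mulrA; apply: ler_wpM2l => //.
  rewrite mulrA -[leRHS]mul1r ler_wpM2r ?expR_ge0 //; exact: expr_expR_le1.
have sea0 : 0 <= s * expR a by rewrite mulr_ge0 ?expR_ge0.
have e1le := expR1_le; have e10 := expR_gt0 (1 : R).
have {h2} h2 : 6 * n < (s * expR a) * (D * opt).
  by rewrite [s * _]mulrC -mulrA.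
have [dE|dE] : d = 2%N \/ d = 3%N by clear -d2 d4; lia.
- have DE : D = 2 by rewrite /D dE.
  rewrite DE in epsge sle h1 h2 ea2.
  have ele : expR ((2 - 1) * (1 - s)) <= expR 1 by rewrite ler_expR; lra.
  have s4 : s <= 1 / 4 by lra.
  have sq1 : (s * expR a) ^+ 2 <= 1 ^+ 2.
    apply: (le_trans ea2); rewrite expr1n.
    by apply: (le_trans (ler_pM s0 (expR_ge0 _) s4 ele)); lra.
  have {}sq1 : s * expR a <= 1 by move: sq1; rewrite ler_sqr ?nnegrE // ler01.
  have h3 : (1 - eps) * s <= 3 / 4 * (1 / 4) by apply: ler_pM; lra.
  have := ler_wpM2r (ltW opt0) h3; have := ler_wpM2r (ltW opt0) sq1; lra.
- have DE : D = 3 by rewrite /D dE.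
  rewrite DE in epsge sle h1 h2 ea2.
  have ele : expR ((3 - 1) * (1 - s)) <= 288 / 100 * (288 / 100).
    apply: (@le_trans _ _ (expR 1 * expR 1)); first by rewrite -expRD ler_expR; lra.
    by apply: ler_pM => //; apply: ltW.
  have s3 : s <= 1 / 3 by lra.
  have sq1 : (s * expR a) ^+ 2 <= (5 / 3) ^+ 2.
    apply: (le_trans ea2).
    by apply: (le_trans (ler_pM s0 (expR_ge0 _) s3 ele)); lra.
  have {}sq1 : s * expR a <= 5 / 3.
    by move: sq1; rewrite ler_sqr ?nnegrE // divr_ge0.
  (* The two estimates meet exactly at [n = 5 / 6 * opt]; the contradiction comes from the
     strictness of [h2]. *)
  have h3 : (1 - eps) * s <= 2 / 3 * (1 / 3) by apply: ler_pM; lra.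
  have := ler_wpM2r (ltW opt0) h3; have := ler_wpM2r (ltW opt0) sq1; lra.
Qed.

(** The left side is the exponent of the Chernoff bound with parameter 6/5: [D0] stands for the gap
    [D], [A / 5] for the tolerated number of repairs, and [A - D0] bounds the mean of [U] from
    below. *)
Lemma failure_bound (d A Z D0 eps : R) : 4 <= d -> (d - 1) / (2 * d) <= eps ->
  0 <= A -> Z = (1 - eps) * A / 2 -> d - 1 <= D0 -> D0 <= Z ->
  6 / 5 * (Z - D0 + A / 5) - (1 - expR (- (6 / 5))) * (A - D0) <= - (229 / 100).
Proof.
move=> d4 epsge A0 ZE dD0 D0Z.
have e38 : 3 / 8 <= eps.
  by apply: le_trans epsge; rewrite ler_pdivlMr; lra.
have := expR_6_5_ge; have := expRxMexpNx_1 (6 / 5 : R).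
set z := expR (- _) => z1 zge.
have z0 : 0 < z by apply: expR_gt0.
have {z1 zge} zle : z <= 303 / 1000 by nra.
have A1 : 16 / 5 * Z <= A.
  have : 0 <= A * (eps - 3 / 8) by apply: mulr_ge0 => //; rewrite subr_ge0.
  by clear -ZE; lra.
have DD : 3 <= D0 by lra.
have Z3 : 3 <= Z by lra.
clear d d4 epsge dD0 eps e38 ZE A0.
(* The expression is affine, and decreasing in [A], in [D0] and, once [A = 16 / 5 * Z], in [Z]. The
   worst case is [D0 = Z = 3], where [z <= 0.303] gives less than -2.29. *)
have h1 : 0 <= (19 / 25 - z) * (A - 16 / 5 * Z) by apply: mulr_ge0; lra.
have h2 : 0 <= (1 / 5 + z) * (D0 - 3) by apply: mulr_ge0; lra.
have h3 : 0 <= (154 / 125 - 16 / 5 * z) * (Z - 3) by apply: mulr_ge0; lra.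
lra.
Qed.

(** Since [k * (1 - eps) >= 1 - eps ^+ k], twice the right side is at least [D * (1 - eps ^+ k) >=
    (D + 1) / 2 >= 5 / 2]. *)
Lemma a_param_ge k (D eps : R) : 4 <= D -> 0 <= eps -> eps <= 1 ->
  eps ^+ k <= (D - 1) / (2 * D) ->
  5 / 4 <= (k%:R * (1 - eps) + (D - 1) * (1 - eps ^+ k)) / 2.
Proof.
move=> D4 e0 e1 sle; have := bernoulli_upper k _ e0 e1.
have : (D + 1) / 2 <= D * (1 - eps ^+ k).
  have -> : (D + 1) / 2 = D * (1 - (D - 1) / (2 * D)) by field; lra.
  by rewrite ler_wpM2l //; lra.
lra.
Qed.

End RealInequalities.

(** * Independent coins *)

Section IndependentCoins.
Context {R : realType} {I : finType} (p : I -> R).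
Implicit Types (w : {ffun I -> bool}) (F : {set I}).

Definition coins_weight w : R := \prod_i (if w i then p i else 1 - p i).

Definition coins_mean (f : {ffun I -> bool} -> R) : R :=
  \sum_w f w * coins_weight w.

Definition all_tails F w : bool := [forall i in F, ~~ w i].

Lemma all_tailsP F w : reflect {in F, forall i, ~~ w i} (all_tails F w).
Proof. exact: forall_inP. Qed.

Lemma coins_probE (A : pred {ffun I -> bool}) :
  coins_prob p A = coins_mean (fun w => (A w)%:R).
Proof.
rewrite /coins_prob /coins_mean big_mkcond; apply: eq_bigr => w _.
by case: (A w); rewrite ?mul1r ?mul0r.
Qed.

Lemma coins_mean_all_tails F :
  coins_mean (fun w => (all_tails F w)%:R) = \prod_(i in F) (1 - p i).
Proof.
(* The indicator is itself a product over the coins, so the sum over all outcomes factors coin by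
   coin. *)
pose G i (c : bool) : R :=
  (if i \in F then (~~ c)%:R else 1) * (if c then p i else 1 - p i).
transitivity (\prod_i \sum_(c : bool) G i c).
  rewrite bigA_distr_bigA; apply: eq_bigr => w _.
  rewrite /G big_split /=; congr (_ * _).
  rewrite -big_mkcond /=.
  have [/all_tailsP tw|/forall_inPn [i iF wi]] := boolP (all_tails F w).
    by rewrite big1 // => i /tw ->.
  by rewrite (bigD1 i) //= (negbTE wi) mul0r.
rewrite [RHS]big_mkcond; apply: eq_bigr => i _.
rewrite /G (bigD1 true) //= (bigD1 false) //= big1; last by case.
by rewrite addr0; case: ifP => _; rewrite ?mul0r ?mul1r ?add0r // addrC subrK.
Qed.

Lemma coins_mean1 : coins_mean (fun=> 1) = 1.
Proof.
transitivity (coins_mean (fun w => (all_tails set0 w)%:R)); last first.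
  by rewrite coins_mean_all_tails big_set0.
apply: eq_bigr => w _; congr (_ * _).
by rewrite (introT (all_tailsP _ _)) // => i; rewrite inE.
Qed.

Lemma eq_coins_mean f g : f =1 g -> coins_mean f = coins_mean g.
Proof. by move=> fg; apply: eq_bigr => w _; rewrite fg. Qed.

Lemma coins_meanD f g :
  coins_mean (fun w => f w + g w) = coins_mean f + coins_mean g.
Proof. by rewrite -big_split; apply: eq_bigr => w _; rewrite mulrDl. Qed.

Lemma coins_meanZ (c : R) f :
  coins_mean (fun w => c * f w) = c * coins_mean f.
Proof. by rewrite /coins_mean mulr_sumr; apply: eq_bigr => w _; rewrite mulrA. Qed.

Lemma coins_mean_sum (J : finType) (P : pred J) (f : J -> _ -> R) :
  coins_mean (fun w => \sum_(j | P j) f j w) = \sum_(j | P j) coins_mean (f j).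
Proof.
by rewrite exchange_big; apply: eq_bigr => w _; rewrite mulr_suml.
Qed.

Context {J : eqType} (block : I -> J) (active : pred I).

Let coins_of (j : J) : {set I} := [set i | active i && (block i == j)].

(* Expanding each factor [1 - z * _] only leaves means of indicators of
   "all coins of F show tails", for disjoint unions F of blocks. *)
Lemma coins_mean_prod_blocks (z : R) (r : seq J) F :
  uniq r -> {in F, forall i, block i \notin r} ->
  coins_mean (fun w => (all_tails F w)%:R *
                       \prod_(j <- r) (1 - z * (all_tails (coins_of j) w)%:R)) =
  \prod_(i in F) (1 - p i) *
    \prod_(j <- r) (1 - z * \prod_(i in coins_of j) (1 - p i)).
Proof.
elim: r F => [|j r IH] F.
  move=> _ _; rewrite big_nil mulr1 -coins_mean_all_tails.
  by apply: eq_coins_mean => w; rewrite big_nil mulr1.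
move=> /= /andP[jr ur] Fr.
have Fj : [disjoint F & coins_of j].
  rewrite disjoint_subset; apply/fintype.subsetP => i /Fr.
  by rewrite !inE negb_or negb_and => /andP[/negbTE -> _]; rewrite orbT.
transitivity (coins_mean (fun w => (all_tails F w)%:R *
      \prod_(j' <- r) (1 - z * (all_tails (coins_of j') w)%:R) +
    (- z) * ((all_tails (F :|: coins_of j) w)%:R *
      \prod_(j' <- r) (1 - z * (all_tails (coins_of j') w)%:R)))).
  apply: eq_coins_mean => w; rewrite big_cons.
  have -> : all_tails (F :|: coins_of j) w
          = all_tails F w && all_tails (coins_of j) w.
    apply/all_tailsP/andP => [tw|[/all_tailsP tF /all_tailsP tj] i].
      by split; apply/all_tailsP => i iF; apply: tw; rewrite inE iF ?orbT.
    by rewrite inE => /orP[/tF|/tj].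
  by rewrite -mulnb natrM; ring.
rewrite coins_meanD coins_meanZ IH //; last first.
  by move=> i /Fr; rewrite inE negb_or => /andP[].
rewrite IH //; last first.
  move=> i /setUP[/Fr|]; first by rewrite inE negb_or => /andP[].
  by rewrite inE => /andP[_ /eqP ->].
rewrite big_cons (_ : \prod_(i in F :|: _) _ =
  \prod_(i in [predU F & coins_of j]) (1 - p i)); last first.
  by apply: eq_bigl => i; rewrite finset.in_setU.
by rewrite bigU //=; ring.
Qed.

Hypothesis p01 : forall i, 0 <= p i <= 1.

Lemma coins_weight_ge0 w : 0 <= coins_weight w.
Proof.
by apply: prodr_ge0 => i _; have /andP[? ?] := p01 i; case: ifP => _ //; rewrite subr_ge0.
Qed.

Lemma le_coins_mean f g :
  (forall w, f w <= g w) -> coins_mean f <= coins_mean g.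
Proof. by move=> fg; apply: ler_sum => w _; rewrite ler_wpM2r // coins_weight_ge0. Qed.

End IndependentCoins.

(** * Optimal fractional solutions *)

Section Optimum.
Context {R : realType} {V : finType} (E : {set {set V}}) (b : V -> nat).
Context (x : {set V} -> R).
Hypothesis x_optimal : lp_optimal E b x.

Lemma lp_optE : lp_opt E b = lp_value E x.
Proof.
have [xf xmin] := x_optimal.
have lb : lbound [set lp_value E y | y in lp_feasible E b]%classic (lp_value E x).
  by move=> _ [y yf <-]; apply: xmin.
apply/le_anti/andP; split.
  by apply: ge_inf; [exists (lp_value E x) | exists x].
by apply: lb_le_inf => //; exists (lp_value E x), x.
Qed.

(** A ratio test in which the sum of all [|h i| / u i] stands in for their maximum. Division by 0
    gives 0, so an index with [u i = 0] does not restrict [t]; there the sign of [h] is assumed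
    instead. *)
Lemma ratio_bound (J : finType) (u h : J -> R) (t : R) (j : J) :
  (forall i, 0 <= u i) -> (u j = 0 -> 0 <= h j) -> 0 <= t ->
  t * (1 + \sum_i `|h i| / u i) <= 1 -> 0 <= u j + t * h j.
Proof.
move=> u0 uh t0 tb.
have [uj0|ujN0] := eqVneq (u j) 0; first by rewrite uj0 add0r mulr_ge0 // uh.
have uj : 0 < u j by rewrite lt_def ujN0 u0.
have : t * `|h j| <= u j.
  rewrite -[leRHS]mul1r -ler_pdivrMr // -mulrA; apply: le_trans tb; apply: ler_wpM2l => //.
  rewrite (bigD1 j) //= addrCA lerDl addr_ge0 // sumr_ge0 // => i _.
  by rewrite divr_ge0.
have := ler_norm (- (t * h j)); rewrite normrN normrM (ger0_norm t0); lra.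
Qed.

(* [x + t h] is feasible for small [t > 0]. *)
Lemma lp_optimal_direction (h : {set V} -> R) :
  (forall e, e \in E -> x e = 0 -> 0 <= h e) ->
  (forall e, e \in E -> x e = 1 -> h e <= 0) ->
  (forall v, \sum_(e in E | v \in e) x e = (b v)%:R ->
     0 <= \sum_(e in E | v \in e) h e) ->
  0 <= \sum_(e in E) h e.
Proof.
move=> h0 h1 hv; have [[cov x01] xmin] := x_optimal.
(* [u1], [u2], [u3] are the slacks of [0 <= x], of [x <= 1] and of the covering constraints; the
   value 1 outside [E] keeps them nonnegative on the whole type. *)
pose u1 e := if e \in E then x e else 1.
pose u2 e := if e \in E then 1 - x e else 1.
pose u3 v := \sum_(e in E | v \in e) x e - (b v)%:R.
pose h3 v := \sum_(e in E | v \in e) h e.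
have u1P e : 0 <= u1 e by rewrite /u1; case: ifP => // /x01 /andP[].
have u2P e : 0 <= u2 e by rewrite /u2; case: ifP => // /x01 /andP[]; lra.
have u3P v : 0 <= u3 v by rewrite /u3 subr_ge0.
have sum_ge0 (J : finType) (u k : J -> R) :
    (forall i, 0 <= u i) -> 0 <= \sum_i `|k i| / u i.
  by move=> uP; apply: sumr_ge0 => i _; rewrite divr_ge0.
set s1 := \sum_e `|h e| / u1 e; set s2 := \sum_e `|- h e| / u2 e.
set s3 := \sum_v `|h3 v| / u3 v.
have s1P : 0 <= s1 by apply: sum_ge0.
have s2P : 0 <= s2 by apply: (sum_ge0 _ _ (fun e => - h e)).
have s3P : 0 <= s3 by apply: sum_ge0.
pose t := (1 + s1 + s2 + s3)^-1.
have tP : 0 < t by rewrite invr_gt0; lra.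
have tb : t * (1 + s1 + s2 + s3) = 1 by rewrite mulVf //; lra.
have t1 : t * (1 + s1) <= 1 by nra.
have t2 : t * (1 + s2) <= 1 by nra.
have t3 : t * (1 + s3) <= 1 by nra.
have feas : lp_feasible E b (fun e => x e + t * h e).
  split=> [v|e eE].
    rewrite big_split /= -mulr_sumr -subr_ge0 addrAC.
    apply: (ratio_bound _ u3 h3) => //; last exact: ltW.
    by move/eqP; rewrite subr_eq0 => /eqP /hv.
  have := ratio_bound _ u1 h t e u1P _ (ltW tP) t1.
  have := ratio_bound _ u2 (fun e => - h e) t e u2P _ (ltW tP) t2.
  rewrite /u1 /u2 eE => H2 H1; apply/andP; split.
    by apply: H1; apply: h0.
  rewrite -subr_ge0 opprD addrA -mulrN; apply: H2 => /eqP.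
  by rewrite subr_eq0 eq_sym => /eqP /h1; rewrite oppr_ge0; apply.
have := xmin _ feas.
by rewrite /lp_value big_split /= lerDl -mulr_sumr pmulr_rge0.
Qed.

End Optimum.

(** * Demands and thresholds *)

Section Demands.
Context {V : finType} (E : {set {set V}}) (b : V -> nat).
Hypothesis V_nonempty : (0 < #|V|)%N.
Hypothesis b_ge2 : forall v, (2 <= b v)%N.
Hypothesis b_le_degree : forall v, (b v <= degree E v - 1)%N.

Lemma min_demand_le v : (min_demand b <= b v)%N.
Proof.
rewrite /min_demand; move: (\max_v b v)%N (mem_index_enum v) => m.
elim: index_enum => //= u r IH; rewrite inE big_cons.
case/orP => [/eqP <-|/IH]; first exact: geq_minl.
by move=> h; exact: leq_trans (geq_minr _ _) h.
Qed.

Lemma min_demand_ge2 : (2 <= min_demand b)%N.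
Proof.
rewrite /min_demand; apply: (big_ind (fun m => 2 <= m)%N) => [|m n m2 n2|v _] //.
  have [v _] := card_gt0P V_nonempty.
  exact: leq_trans (b_ge2 v) (leq_bigmax v).
by rewrite leq_min m2.
Qed.

(** The truncated subtraction in [delta] is exact, because [min_demand b <= b v < degree E v <=
    max_degree E]. *)
Lemma degree_le_delta v : (degree E v + 1 <= delta E b + b v)%N.
Proof.
have := leq_bigmax (F := degree E) v; have := min_demand_le v.
have := b_le_degree v; have := b_ge2 v; rewrite /delta /max_degree; lia.
Qed.

Lemma delta_ge2 : (2 <= delta E b)%N.
Proof.
have [v _] := card_gt0P V_nonempty; have := degree_le_delta v.
have := b_le_degree v; have := b_ge2 v; lia.
Qed.

End Demands.

Section Fractional.
Context {R : realType} {V : finType} (E : {set {set V}}) (b : V -> nat).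
Context (x : {set V} -> R).
Hypothesis V_nonempty : (0 < #|V|)%N.
Hypothesis b_ge2 : forall v, (2 <= b v)%N.
Hypothesis b_le_degree : forall v, (b v <= degree E v - 1)%N.
Hypothesis x_feasible : lp_feasible E b x.

Local Notation dlt := ((delta E b)%:R : R).

Lemma cardsE_sum (C : {set {set V}}) v :
  #|[set e in C | v \in e]|%:R = \sum_(e in C | v \in e) (1 : R).
Proof. by rewrite -sum1_card natr_sum; apply: eq_bigl => e; rewrite !inE. Qed.

Lemma sum_incidence (C : {set {set V}}) (f : {set V} -> R) :
  \sum_v \sum_(e in C | v \in e) f e = \sum_(e in C) #|e|%:R * f e.
Proof.
rewrite (exchange_big_dep (mem C)) /=; last by move=> v e _ /andP[].
apply: eq_bigr => e eC; rewrite mulr_natl -sumr_const.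
by apply: eq_bigl => v; rewrite eC.
Qed.

Lemma degree_le_deltaR v : (degree E v)%:R + 1 <= dlt + (b v)%:R :> R.
Proof. by rewrite natr1 -natrD ler_nat -addn1 degree_le_delta. Qed.

Lemma delta_ge2R : 2 <= dlt.
Proof. by rewrite (ler_nat R 2) delta_ge2. Qed.

(** Let [c] of the [d] edges at [v] reach the threshold. Rounding [x] up to 1 on these and to
    [th^-1] on the others bounds [b v] by [c + (d - c) / th]; it remains to insert
    [d <= dlt + b v - 1]. *)
Lemma threshold_count (th : R) v : 1 < th ->
  (th - 1) *
    ((b v)%:R - #|[set e in [set e in E | th^-1 <= x e] | v \in e]|%:R) <
  dlt - 1.
Proof.
move=> th1; set C := [set e in E | _]; set c := #|_|%:R.
have dle := degree_le_deltaR v; have d2 := delta_ge2R.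
have th0 : 0 < th by lra.
have bd : (b v)%:R + 1 <= (degree E v)%:R :> R.
  by rewrite natr1 ler_nat; have := b_le_degree v; have := b_ge2 v; lia.
have [cov x01] := x_feasible; have covv := cov v.
pose f e : R := (th^-1 <= x e)%R%:R * (1 - th^-1) + th^-1.
have xf e : e \in E -> x e <= f e.
  move=> /x01 /andP[x0 x1]; rewrite /f.
  by case: (lerP th^-1 (x e)) => [_|/ltW]; rewrite ?mul1r ?mul0r; lra.
have fE : \sum_(e in E | v \in e) f e = c * (1 - th^-1) + (degree E v)%:R * th^-1.
  rewrite big_split /= -mulr_suml; congr (_ * _ + _).
    rewrite /c cardsE_sum.
    rewrite [RHS](eq_bigl (fun e => ((e \in E) && (v \in e)) && (th^-1 <= x e))).
      by rewrite [RHS]big_mkcondr; apply: eq_bigr => e _; case: (th^-1 <= x e).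
    by move=> e; rewrite !inE andbAC.
  by rewrite /degree cardsE_sum mulr_suml; apply: eq_bigr => e; rewrite mul1r.
have fth : th * (c * (1 - th^-1) + (degree E v)%:R * th^-1) =
    c * (th - 1) + (degree E v)%:R.
  by field; lra.
(* If every edge at [v] reaches the threshold, the rounding need not be strict anywhere; but then
   [c] is the degree, which exceeds [b v], and the left side is negative. *)
have [/forall_inP ge|/forall_inPn [e0]] :=
    boolP [forall e in [set e in E | v \in e], th^-1 <= x e].
  have -> : c = (degree E v)%:R.
    rewrite /c /degree; congr (_%:R); apply: eq_card => e; rewrite !inE.
    have := ge e; rewrite !inE.
    by case: (e \in E); case: (v \in e); rewrite ?andbF // => /(_ isT) ->.
  nra.
rewrite inE => /andP[e0E ve0]; rewrite -ltNge => xe0.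
have : \sum_(e in E | v \in e) x e < \sum_(e in E | v \in e) f e.
  rewrite (bigD1 e0) /= ?e0E // [ltRHS](bigD1 e0) /= ?e0E //.
  apply: ltr_leD; first by rewrite /f leNgt xe0 mul0r add0r.
  by apply: ler_sum => e /andP[/andP[/xf]].
rewrite fE => lt1; have : th * (b v)%:R < c * (th - 1) + (degree E v)%:R.
  by rewrite -fth ltr_pM2l //; apply: le_lt_trans lt1.
lra.
Qed.

Lemma lambda_gt1 : 1 < lambda E b :> R.
Proof. by rewrite /lambda; have := delta_ge2R; lra. Qed.

Lemma lambda_lt_delta : lambda E b < dlt :> R.
Proof. by rewrite /lambda; have := delta_ge2R; lra. Qed.

Lemma inv_delta_lt : dlt^-1 < (lambda E b)^-1 :> R.
Proof.
by rewrite ltf_pV2 ?posrE ?lambda_lt_delta //; have := lambda_gt1; have := delta_ge2R; lra.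
Qed.

Lemma edges12E : edges1 E b x :|: edges2 E b x = [set e in E | dlt^-1 <= x e].
Proof.
apply/setP => e; rewrite !inE; case: (e \in E) => //=.
have [h|h] := leP (lambda E b)^-1 (x e); last by rewrite andbT.
by rewrite (le_trans (ltW inv_delta_lt) h).
Qed.

Lemma edges123E :
  edges1 E b x :|: edges2 E b x :|: edges3 E b x = [set e in E | 0 < x e].
Proof.
apply/setP => e; rewrite edges12E !inE; case: (e \in E) => //=.
have d0 : 0 < dlt^-1 by rewrite invr_gt0; have := delta_ge2R; lra.
have [h|h] := leP dlt^-1 (x e); last by rewrite andbT.
by rewrite (lt_le_trans d0 h).
Qed.

(** At [th = lambda], [th - 1] is half of [dlt - 1], so the deficit at [v] is an integer below 2. *)
Lemma card_edges1_ge v : (b v <= #|[set e in edges1 E b x | v \in e]| + 1)%N.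
Proof.
have := threshold_count _ v lambda_gt1.
rewrite -/(edges1 E b x); set c := #|_|; rewrite /lambda => h.
suff : (b v)%:R < c%:R + 2 :> R by rewrite -natrD ltr_nat; lia.
have := delta_ge2R; nra.
Qed.

(** At [th = dlt] the deficit is an integer below 1. *)
Lemma card_edges12_ge v :
  (b v <= #|[set e in edges1 E b x :|: edges2 E b x | v \in e]|)%N.
Proof.
have d1 : 1 < dlt by have := delta_ge2R; lra.
have := threshold_count _ v d1; rewrite -edges12E; set c := #|_| => h.
suff : (b v)%:R < c%:R + 1 :> R by rewrite natr1 ltr_nat; lia.
nra.
Qed.

(** * Cost and outcome of the repairs *)

Lemma fully_coveredW (C D : {set {set V}}) v :
  C \subset D -> fully_covered b C v -> fully_covered b D v.
Proof.
move=> /subsetP CD; rewrite /fully_covered => /leq_trans; apply.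
by apply/subset_leq_card/subsetP => e; rewrite !inE => /andP[/CD -> ->].
Qed.

Lemma edges12_multicover : set_multicover E b (edges1 E b x :|: edges2 E b x).
Proof.
rewrite /set_multicover; apply/andP; split; last first.
  by apply/forallP => v; apply: card_edges12_ge.
by rewrite edges12E; apply/subsetP => e; rewrite inE => /andP[].
Qed.

Definition uncovered (C : {set {set V}}) : {set V} :=
  [set v | ~~ fully_covered b C v].

(* Every vertex lies in at least [b v - 1] edges of [edges1], so that one repair
   edge suffices for it. *)
Lemma repair_step_cost (C D : {set {set V}}) :
  edges1 E b x \subset C -> repair_step E b x C D ->
  [/\ C \subset D, D \subset C :|: edges2 E b x &
      (#|D| + #|uncovered D| <= #|C| + #|uncovered C|)%N].
Proof.
move=> C1 /existsP[e /andP[eC /andP[/existsP[v /andP[ve vC]] /eqP ->]]].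
move: eC; rewrite inE => /andP[eNC e2].
split; first exact: subsetUr.
  by rewrite subUset subsetUl sub1set inE e2 orbT.
rewrite cardsU1 eNC -addnA add1n -addnS leq_add2l.
have vU : v \in uncovered C by rewrite inE.
rewrite [leqRHS](cardsD1 v) vU ltnS; apply/subset_leq_card/subsetP => u.
rewrite !inE => uD; apply/andP; split; last first.
  by apply: contra uD; apply: fully_coveredW; apply: subsetUr.
apply: contraNneq uD => ->; rewrite /fully_covered.
have -> : [set f in e |: C | v \in f] = e |: [set f in C | v \in f].
  by apply/setP => f; rewrite !inE andb_orl; case: eqP => // ->; rewrite ve.
rewrite cardsU1 inE (negbTE eNC) /= addnC.
apply: leq_trans (card_edges1_ge v) _; rewrite leq_add2r.
apply/subset_leq_card/subsetP => f; rewrite !in_set => /andP[e1 ->].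
by rewrite (subsetP C1) // in_set.
Qed.

(** [#|C| + #|uncovered C|] never increases along a sequence of repair steps. *)
Lemma repair_cost (C D : {set {set V}}) :
  edges1 E b x \subset C -> connect (repair_step E b x) C D ->
  [/\ C \subset D, D \subset C :|: edges2 E b x &
      (#|D| <= #|C| + #|uncovered C|)%N].
Proof.
move=> C1 /connectP[s]; elim: s C C1 => [|C' s IH] C C1 /=.
  by move=> _ ->; rewrite subsetUl leq_addr.
move=> /andP[st pt] DE.
have [CC' C'2 le1] := repair_step_cost _ _ C1 st.
have [C'D D2 le2] := IH _ (subset_trans C1 CC') pt DE.
split; first exact: subset_trans CC' C'D.
  apply: subset_trans D2 _; rewrite subUset C'2; exact: subsetUr.
exact: leq_trans le2 le1.
Qed.

(** If [v] were uncovered at the end, a missing edge of [edges2] through [v] would allow another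
    step. So all edges of [edges1] and [edges2] through [v] are present, and these suffice. *)
Lemma repaired_multicover (C D : {set {set V}}) :
  edges1 E b x \subset C -> C \subset E -> repaired E b x C D ->
  set_multicover E b D.
Proof.
move=> C1 CE /andP[CD /forallP maxD]; have [sCD sD _] := repair_cost _ _ C1 CD.
apply/andP; split.
  apply: subset_trans sD _; rewrite subUset CE.
  by apply/subsetP => e; rewrite inE => /andP[].
apply/forallP => v; apply: contraT => vD.
suff : edges1 E b x :|: edges2 E b x \subset D :|: [set e : {set V} | v \notin e].
  move=> /subsetP h; move: vD; rewrite /fully_covered.
  rewrite (leq_trans (card_edges12_ge v)) //.
  apply/subset_leq_card/subsetP => e; rewrite in_set => /andP[/h].
  by rewrite !in_set => /orP[->|/negbTE ->].
rewrite subUset (subset_trans (subset_trans C1 sCD) (subsetUl _ _)) /=.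
apply/subsetP => e e2; rewrite in_setU in_set; apply: contraT.
rewrite negb_or negbK => /andP[eD ve]; have /negP[] := maxD (e |: D).
apply/existsP; exists e; rewrite in_setD eD e2 /=.
by rewrite eqxx andbT; apply/existsP; exists v; rewrite ve.
Qed.

(** * Sums over the edge classes and double counting *)

Lemma sum_edges (P : pred {set V}) (f : {set V} -> R) :
  (forall e, x e = 0 -> f e = 0) ->
  \sum_(e in E | P e) f e =
  \sum_(e in edges1 E b x | P e) f e + \sum_(e in edges2 E b x | P e) f e +
  \sum_(e in edges3 E b x | P e) f e.
Proof.
move=> f0; rewrite big_mkcond [X in _ = X + _ + _]big_mkcond.
rewrite [X in _ = _ + X + _]big_mkcond [X in _ = _ + X]big_mkcond -!big_split.
apply: eq_bigr => e _ /=; rewrite !inE.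
have d0 : 0 < dlt^-1 by rewrite invr_gt0; have := delta_ge2R; lra.
have ltdl := inv_delta_lt; have [_ x01] := x_feasible.
have [eE|_] /= := boolP (e \in E); last by rewrite !addr0.
have /andP[x0 _] := x01 e eE.
case: (P e); rewrite ?andbT ?andbF ?addr0 //.
have [h1|h1] := leP (lambda E b)^-1 (x e).
  have hd : dlt^-1 <= x e := le_trans (ltW ltdl) h1.
  by rewrite [x e < dlt^-1]ltNge hd /= andbF !addr0.
have [h2|h2] /= := leP dlt^-1 (x e); first by rewrite andbF add0r addr0.
rewrite andbT !add0r; have [//|h3] := ltP 0 (x e).
by apply: f0; apply/le_anti; rewrite h3.
Qed.

Lemma cardE_sum (T : finType) (C : {set T}) : #|C|%:R = \sum_(e in C) (1 : R).
Proof. by rewrite -sum1_card natr_sum. Qed.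

(** The edges of [edges1] are counted exactly, those of [edges2] through [1 <= dlt * x e]. *)
Lemma edges12_size :
  #|edges1 E b x :|: edges2 E b x|%:R <=
  dlt * lp_value E x - \sum_(e in edges1 E b x) (dlt * x e - 1).
Proof.
have d2 := delta_ge2R; have d0 : 0 < dlt by lra.
have -> : lp_value E x = \sum_(e in edges1 E b x) x e +
    \sum_(e in edges2 E b x) x e + \sum_(e in edges3 E b x) x e.
  by have := sum_edges xpredT x (fun _ => id); rewrite !big_mkcondr.
have h3 : 0 <= \sum_(e in edges3 E b x) x e.
  by apply: sumr_ge0 => e; rewrite inE => /and3P[_ /ltW].
have h2 : #|edges2 E b x|%:R <= dlt * \sum_(e in edges2 E b x) x e.
  rewrite cardE_sum mulr_sumr; apply: ler_sum => e; rewrite inE => /and3P[_ h _].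
  by rewrite mulrC -ler_pdivrMr // mul1r.
rewrite sumrB -mulr_sumr -cardE_sum.
have : #|edges1 E b x :|: edges2 E b x|%:R <=
    #|edges1 E b x|%:R + #|edges2 E b x|%:R :> R.
  by rewrite -natrD ler_nat cardsU leq_subr.
nra.
Qed.

(** On [edges1], [x e >= 2 / (dlt + 1)] yields an excess of at least [(dlt - 1) / (dlt + 1)]; the
    edge with value 1 has excess [dlt - 1], whence strictness. *)
Lemma edges1_excess_strict e : e \in E -> x e = 1 ->
  (dlt - 1) / (dlt + 1) * #|edges1 E b x|%:R <
  \sum_(e in edges1 E b x) (dlt * x e - 1).
Proof.
move=> eE xe; have d2 := delta_ge2R.
have e1 : e \in edges1 E b x.
  by rewrite inE eE xe invf_le1; have := lambda_gt1; lra.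
rewrite cardE_sum mulr_sumr (bigD1 e) //= [ltRHS](bigD1 e) //=.
apply: ltr_leD.
  by rewrite xe !mulr1 ltr_pdivrMr; nra.
apply: ler_sum => e'; rewrite inE => /andP[/andP[_]].
rewrite /lambda invf_div => h _.
have -> : (dlt - 1) / (dlt + 1) * 1 = dlt * (2 / (dlt + 1)) - 1 by field; lra.
by rewrite lerD2r ler_wpM2l //; lra.
Qed.

(** Double counting of the incidences between vertices and [edges1]. *)
Lemma vertices_le_edges1 :
  #|V|%:R * ((min_demand b)%:R - 1) <=
  (max_edge_size E)%:R * #|edges1 E b x|%:R :> R.
Proof.
apply: (@le_trans _ _ (\sum_v \sum_(e in edges1 E b x | v \in e) 1)).
  rewrite mulr_natl -sumr_const; apply: ler_sum => v _.
  rewrite -cardsE_sum lerBlDr natr1 -addn1 ler_nat.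
  exact: leq_trans (min_demand_le b v) (card_edges1_ge v).
rewrite sum_incidence mulr_natr -sumr_const; apply: ler_sum => e.
rewrite inE => /andP[eE _]; rewrite mulr1 ler_nat.
exact: (@leq_bigmax_cond _ (mem E) (fun e : {set V} => #|e|)).
Qed.

Lemma max_edge_size_gt0 : (0 < max_edge_size E)%N.
Proof.
have [v _] := card_gt0P V_nonempty.
have /card_gt0P[e] : (0 < degree E v)%N by have := b_le_degree v; have := b_ge2 v; lia.
rewrite inE => /andP[eE ve].
have /leq_trans : (0 < #|e|)%N by apply/card_gt0P; exists v.
by apply; apply: (@leq_bigmax_cond _ (mem E) (fun e : {set V} => #|e|)).
Qed.

Lemma lp_value_gt0 : 0 < lp_value E x.
Proof.
have [v _] := card_gt0P V_nonempty; have [cov x01] := x_feasible.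
have : 0 < \sum_(e in E | v \in e) x e.
  by apply: lt_le_trans (cov v); rewrite ltr0n; have := b_ge2 v; lia.
move=> /lt_le_trans; apply; rewrite /lp_value big_mkcondr.
by apply: ler_sum => e /x01 /andP[]; case: ifP.
Qed.

(** * Consequences of optimality for the support of [x] *)

Hypothesis x_optimal : lp_optimal E b x.

Lemma empty_edge_unused : set0 \in E -> x set0 = 0.
Proof.
move=> E0; have [_ x01] := x_feasible; have /andP[x0 _] := x01 _ E0.
apply/eqP; apply: contraT => xN0.
have := lp_optimal_direction E b x x_optimal (fun e => if e == set0 then -1 else 0).
rewrite (bigD1 set0) //= eqxx big1 => [|e /andP[_ /negbTE -> //]].
rewrite addr0 oppr_ge0 => h; suff : 1 <= 0 :> R by lra.
apply: h => [e _|e _ _|v _].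
- by case: eqP => // -> /eqP; rewrite (negbTE xN0).
- by case: ifP; rewrite ?lerN10.
- by apply: sumr_ge0 => e /andP[_]; case: eqP => // ->; rewrite inE.
Qed.

(** The summand, extended by 0, is an admissible direction. At a tight [v] put [W = b v - q]: at
    most [dlt - 1 + W] edges are fractional, so if [W > 0] the direction sums to at least
    [(dlt - 1) * (W - 1) - kap * W], nonnegative by hypothesis. *)
Lemma interior_excess (kap : R) :
  (forall v, let q := #|[set e in E | (x e == 1) && (v \in e)]| in (q < b v)%N ->
     kap * ((b v)%:R - q%:R) <= (dlt - 1) * ((b v)%:R - q%:R - 1)) ->
  0 <= \sum_(e in E | 0 < x e < 1) ((dlt - kap) * x e - 1).
Proof.
move=> kapP; rewrite big_mkcondr; apply: (lp_optimal_direction E b x x_optimal).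
- by move=> e _ ->; rewrite ltxx.
- by move=> e _ ->; rewrite ltxx andbF.
move=> v tight; have [_ x01] := x_feasible.
have := kapP v; set Q := [set e in E | _]; set q := #|_| => /= hq.
pose Z := [set e in E | (0 < x e < 1) && (v \in e)].
have qE : q%:R = \sum_(e in E | v \in e) (x e == 1)%:R :> R.
  rewrite /q cardE_sum big_mkcond [RHS]big_mkcond; apply: eq_bigr => e _.
  by rewrite inE; case: (e \in E); case: (v \in e); case: (x e == 1).
have zE : #|Z|%:R = \sum_(e in E | v \in e) (0 < x e < 1)%R%:R :> R.
  rewrite cardE_sum big_mkcond [RHS]big_mkcond; apply: eq_bigr => e _.
  by rewrite inE; case: (e \in E); case: (v \in e); case: (0 < x e < 1).
have qz : q%:R + #|Z|%:R <= (degree E v)%:R :> R.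
  rewrite qE zE -big_split /degree cardsE_sum; apply: ler_sum => e _ /=.
  by have [->|xN1] := eqVneq (x e) 1; rewrite ?ltxx ?andbF ?addr0 // add0r lern1 leq_b1.
have dle := degree_le_deltaR v.
have sumE : \sum_(e in E | v \in e)
    (if 0 < x e < 1 then (dlt - kap) * x e - 1 else 0) =
    (dlt - kap) * ((b v)%:R - q%:R) - #|Z|%:R.
  rewrite -tight qE zE -sumrB mulr_sumr -sumrB; apply: eq_bigr => e /andP[eE _].
  have /andP[x0 x1] := x01 e eE.
  have [->|xN1] := eqVneq (x e) 1; first by rewrite ltxx andbF subrr mulr0 subrr.
  have [->|xN0] := eqVneq (x e) 0.
    by rewrite ltxx /= !subr0 mulr0.
  by rewrite !lt_def xN0 x0 eq_sym xN1 x1 subr0.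
have WE : (b v)%:R - q%:R = \sum_(e in Z) x e.
  rewrite -tight qE -sumrB.
  rewrite [RHS](eq_bigl (fun e => (e \in E) && (v \in e) && (0 < x e < 1))).
    rewrite [RHS]big_mkcondr; apply: eq_bigr => e /andP[eE _].
    have /andP[x0 x1] := x01 e eE.
    have [->|xN1] := eqVneq (x e) 1; first by rewrite ltxx andbF subrr.
    have [->|xN0] := eqVneq (x e) 0; first by rewrite ltxx subr0.
    by rewrite !lt_def xN0 x0 eq_sym xN1 x1 subr0.
  by move=> e; rewrite inE andbCA [RHS]andbC; case: (e \in E); rewrite ?andbF.
(* Without fractional edges at [v], tightness forces [b v = q] and the sum vanishes. *)
rewrite sumE; have [Z0|[e0 e0Z]] := set_0Vmem Z.
  by rewrite WE Z0 big_set0 mulr0 cards0 subr0.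
have W0 : 0 < (b v)%:R - q%:R :> R.
  rewrite WE (bigD1 e0) //= ltr_wpDr //.
    by apply: sumr_ge0 => e; rewrite inE => /andP[/and3P[_ /andP[/ltW]]].
  by move: e0Z; rewrite inE => /and3P[_ /andP[]].
have := hq; rewrite -(ltr_nat R) -subr_gt0 => /(_ W0); nra.
Qed.

Local Notation support := [set e in E | 0 < x e].

Lemma lp_value_support : lp_value E x = \sum_(e in support) x e.
Proof.
have [_ x01] := x_feasible.
rewrite /lp_value [RHS](eq_bigl (fun e => (e \in E) && (0 < x e))); last first.
  by move=> e; rewrite inE.
rewrite [RHS]big_mkcondr; apply: eq_bigr => e /x01 /andP[x0 _].
by case: ltP => // h; apply/le_anti; rewrite x0 h.
Qed.

Lemma support_excessE (kap : R) :
  (dlt - kap) * lp_value E x - #|support|%:R =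
  \sum_(e in E | 0 < x e < 1) ((dlt - kap) * x e - 1) +
  \sum_(e in E | x e == 1) (dlt - kap - 1).
Proof.
have [_ x01] := x_feasible.
rewrite lp_value_support cardE_sum mulr_sumr -sumrB.
rewrite (eq_bigl (fun e => (e \in E) && (0 < x e))); last by move=> e; rewrite inE.
rewrite (bigID (fun e => x e == 1)) /= addrC; congr (_ + _).
  apply: eq_bigl => e; case: (boolP (e \in E)) => //= /x01 /andP[_ x1].
  by rewrite [x e < 1]lt_def x1 andbT eq_sym.
apply: eq_big => [e|e /andP[_ /eqP ->]]; last by rewrite mulr1.
by rewrite -andbA; case: eqP => [->|_]; rewrite ?andbF ?ltr01.
Qed.

(** If some edge has value 1, [kap = 0] is admissible and that edge alone contributes [dlt - 1].
    Otherwise every [q] is 0, and [kap = (dlt - 1) / 2] is admissible because [b v >= 2]. *)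
Lemma support_excess :
  (dlt - 1) / 2 * lp_value E x <= dlt * lp_value E x - #|support|%:R \/
  (exists2 e, e \in E & x e = 1) /\
  dlt - 1 <= dlt * lp_value E x - #|support|%:R.
Proof.
have d2 := delta_ge2R.
have [/existsP[e1 /andP[e1E /eqP xe1]]|/existsPn none] :=
    boolP [exists e, (e \in E) && (x e == 1)].
  right; split; first by exists e1.
  have := support_excessE 0; rewrite !subr0 => ->.
  have h0 : 0 <= \sum_(e in E | 0 < x e < 1) (dlt * x e - 1).
    have := interior_excess 0; rewrite subr0; apply=> v q qb.
    rewrite mul0r mulr_ge0 //; first by lra.
    by rewrite -addrA -opprD natr1 subr_ge0 ler_nat.
  rewrite -[leLHS]add0r lerD // (bigD1 e1) /=; last by rewrite e1E xe1 eqxx.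
  by rewrite lerDl; apply: sumr_ge0 => e _; lra.
left; have := support_excessE ((dlt - 1) / 2).
rewrite [X in _ = _ + X]big_pred0 => [|e]; last by have := none e => /negbTE.
have : 0 <= \sum_(e in E | 0 < x e < 1) ((dlt - (dlt - 1) / 2) * x e - 1).
  apply: interior_excess => v q _.
  have -> : q = 0%N.
    apply/eqP; rewrite cards_eq0; apply/eqP/setP => e; rewrite !inE andbA.
    by have := none e => /negbTE ->.
  rewrite subr0; have : 2 <= (b v)%:R :> R by rewrite (ler_nat R 2).
  by move: d2; nra.
by lra.
Qed.

(** Edges of the support are nonempty, so [1 - x e <= #|e| * (1 - x e)]. After exchanging
    summations, each vertex contributes its degree minus its coverage, at most [dlt - 1]. *)
Lemma support_size :
  #|support|%:R <= lp_value E x + (dlt - 1) * #|V|%:R.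
Proof.
have [cov x01] := x_feasible.
rewrite -lerBlDl lp_value_support cardE_sum -sumrB.
apply: (@le_trans _ _ (\sum_(e in E) #|e|%:R * (1 - x e))).
  rewrite (eq_bigl (fun e => (e \in E) && (0 < x e))); last by move=> e; rewrite inE.
  rewrite big_mkcondr; apply: ler_sum => e eE; have /andP[x0 x1] := x01 e eE.
  case: ltP => [xe|_]; last by rewrite mulr_ge0 // subr_ge0.
  rewrite ler_peMl ?subr_ge0 // ler1n card_gt0.
  apply: contraTneq xe => e0; move: eE; rewrite e0 => /empty_edge_unused ->.
  by rewrite ltxx.
rewrite -sum_incidence mulr_natr -sumr_const; apply: ler_sum => v _.
rewrite sumrB -cardsE_sum -/(degree E v).
by have := degree_le_deltaR v; have := cov v; lra.
Qed.

(** * The coins, unchosen edges and uncovered vertices *)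

Context (k : nat) (eps : R).
Hypothesis eps_ge : (dlt - 1) / (2 * dlt) <= eps.
Hypothesis eps_le1 : eps <= 1.
Hypothesis epsk_le : eps ^+ k <= (dlt - 1) / (2 * dlt).

Local Notation bias := (coin_bias E b eps x : coin V k -> R).

Definition coin_edge (c : coin V k) : {set V} :=
  match c with inl (e, _) => e | inr e => e end.

Definition coin_active (c : coin V k) : bool :=
  match c with
  | inl (e, _) => e \in edges2 E b x
  | inr e => e \in edges3 E b x
  end.

Definition edge_coins (e : {set V}) : {set coin V k} :=
  [set c | coin_active c && (coin_edge c == e)].

Local Notation edges23 := (edges2 E b x :|: edges3 E b x).

Lemma big_coins (T : Type) (idx : T) (op : Monoid.com_law idx)
    (P : pred {set V}) (F : coin V k -> T) :
  \big[op/idx]_(c | coin_active c && P (coin_edge c)) F c =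
  op (\big[op/idx]_(e in edges2 E b x | P e) \big[op/idx]_(i < k) F (inl (e, i)))
     (\big[op/idx]_(e in edges3 E b x | P e) F (inr e)).
Proof.
rewrite big_sumType /= pair_big /=; congr (op _ _).
by apply: eq_big => [[e i]|[e i] _] //=; rewrite andbT.
Qed.

Lemma eps_ge0 : 0 <= eps.
Proof.
apply: le_trans eps_ge; have := delta_ge2R => d2.
by rewrite divr_ge0 //; lra.
Qed.

Lemma eps_gt0 : 0 < eps.
Proof.
apply: lt_le_trans eps_ge; have := delta_ge2R => d2.
by rewrite divr_gt0 //; lra.
Qed.

Lemma delta_1Bepsk : (dlt + 1) / 2 <= dlt * (1 - eps ^+ k).
Proof.
have d2 := delta_ge2R.
have -> : (dlt + 1) / 2 = dlt * (1 - (dlt - 1) / (2 * dlt)) by field; lra.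
by rewrite ler_wpM2l // ?lerB //; lra.
Qed.

Lemma epsk01 : 0 <= eps ^+ k <= 1.
Proof. by rewrite exprn_ge0 ?exprn_ile1 ?eps_ge0. Qed.

(** The lower bound on [eps] amounts to [lambda0 <= lambda], and [x e < lambda^-1] on [edges2]. *)
Lemma lambda0_le1 e : e \in edges2 E b x -> 0 <= lambda0 E b eps * x e <= 1.
Proof.
rewrite inE => /and3P[_ x1 x2]; have d2 := delta_ge2R.
have x0 : 0 < x e by apply: lt_le_trans x1; rewrite invr_gt0; lra.
rewrite /lambda0; apply/andP; split.
  by rewrite !mulr_ge0 //; [rewrite subr_ge0; apply: eps_le1 | exact: ltW].
have h : (1 - eps) * dlt <= lambda E b.
  have -> : lambda E b = (1 - (dlt - 1) / (2 * dlt)) * dlt.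
    by rewrite /lambda; field; lra.
  by rewrite ler_wpM2r // ?lerB //; lra.
have l1 := lambda_gt1; apply: (@le_trans _ _ (lambda E b * (lambda E b)^-1)).
  apply: ler_pM => //; [|exact: ltW|exact: ltW].
  by rewrite mulr_ge0 // subr_ge0; apply: eps_le1.
by rewrite divff //; lra.
Qed.

Lemma edges3_bias e : e \in edges3 E b x ->
  0 <= (1 - eps ^+ k) * dlt * x e <= 1.
Proof.
rewrite inE => /and3P[_ x0 x1]; have d2 := delta_ge2R.
have /andP[s0 s1] := epsk01.
have d0 : 0 < dlt by lra.
have dx : dlt * x e <= 1 by rewrite mulrC -ler_pdivlMr // mul1r ltW.
have dx0 : 0 <= dlt * x e by rewrite mulr_ge0 // ltW.
rewrite -mulrA; apply/andP; split; first by rewrite mulr_ge0 //; lra.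
by apply: mulr_ile1 => //; lra.
Qed.

Lemma bias01 (c : coin V k) : 0 <= bias c <= 1.
Proof.
case: c => [[e i]|e] /=; case: ifP => [he|_]; rewrite ?lexx ?ler01 //.
  exact: lambda0_le1.
exact: edges3_bias.
Qed.

Definition skip_prob e : R := \prod_(c in edge_coins e) (1 - bias c).

Lemma edges2N3 e : e \in edges2 E b x -> e \in edges3 E b x = false.
Proof.
rewrite !inE => /and3P[_ h _]; rewrite (leNgt dlt^-1) in h.
by rewrite (negbTE h) !andbF.
Qed.

Lemma edges1N23 e : e \in edges1 E b x -> e \in edges23 = false.
Proof.
rewrite !inE => /andP[_ h1]; rewrite ltNge h1 /= !andbF /=.
have hd : dlt^-1 <= x e := le_trans (ltW inv_delta_lt) h1.
by rewrite [x e < _]ltNge hd !andbF.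
Qed.

Lemma skip_prob2 e : e \in edges2 E b x ->
  skip_prob e = (1 - lambda0 E b eps * x e) ^+ k.
Proof.
move=> e2; rewrite /skip_prob (eq_bigl (fun c => coin_active c && (coin_edge c == e))).
  rewrite (big_coins _ _ _ (pred1 e)) /= [X in _ * X]big1; last first.
    by move=> e' /andP[e'3 /eqP e'e]; rewrite e'e (edges2N3 _ e2) in e'3.
  rewrite mulr1 (big_pred1 e) => [|e']; last first.
    by rewrite /= andb_idl // => /eqP ->.
  by rewrite e2 prodr_const card_ord.
by move=> c; rewrite inE.
Qed.

Lemma skip_prob3 e : e \in edges3 E b x ->
  skip_prob e = 1 - (1 - eps ^+ k) * dlt * x e.
Proof.
move=> e3; rewrite /skip_prob (eq_bigl (fun c => coin_active c && (coin_edge c == e))).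
  rewrite (big_coins _ _ _ (pred1 e)) /= [X in X * _]big1; last first.
    by move=> e' /andP[e'2 /eqP e'e]; move: (edges2N3 _ e'2); rewrite e'e e3.
  rewrite mul1r (big_pred1 e) => [|e']; last first.
    by rewrite /= andb_idl // => /eqP ->.
  by rewrite e3.
by move=> c; rewrite inE.
Qed.

(** On [edges2], let [u] be the probability of tails for one flip. Then [dlt * x e >= 1] gives
    [u <= eps], and [geometric_ratio] divided by [1 - eps] is the claim. If [eps = 1], these flips
    never show heads. *)
Lemma skip_prob_ge e : e \in edges23 ->
  1 - (1 - eps ^+ k) * dlt * x e <= skip_prob e.
Proof.
rewrite in_setU => /orP[e2|/skip_prob3 ->] //.
have /andP[l0 l1] := lambda0_le1 _ e2; rewrite skip_prob2 //.
move: e2; rewrite inE => /and3P[_ dx _]; have d2 := delta_ge2R.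
have dx1 : 1 <= dlt * x e.
  by rewrite mulrC -ler_pdivrMr ?mul1r //; lra.
move: l0 l1; rewrite /lambda0 => l0 l1; set u := 1 - (1 - eps) * dlt * x e.
have u0 : 0 <= u by rewrite /u subr_ge0.
have uE : 1 - u = (1 - eps) * (dlt * x e) by rewrite /u; ring.
have ue : u <= eps.
  by have := ler_wpM2l (_ : 0 <= 1 - eps) dx1; rewrite subr_ge0 => /(_ eps_le1); lra.
have := geometric_ratio k eps u u0 ue eps_le1; rewrite uE.
have [e1|eN1] := eqVneq eps 1.
  move=> _; rewrite e1 expr1n subrr !mul0r subr0.
  by rewrite /u e1 subrr !mul0r subr0 expr1n.
rewrite -mulrA ler_pM2l; last by rewrite subr_gt0 lt_def eq_sym eN1.
lra.
Qed.

Lemma in_set_sep (T : finType) (A : {set T}) (P : pred T) e :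
  (e \in [set y in A | P y]) = (e \in A) && P e.
Proof. by rewrite inE. Qed.

Lemma notin_sampled (w : {ffun coin V k -> bool}) e : e \in edges23 ->
  (e \notin sampled E b x w) = all_tails (edge_coins e) w.
Proof.
move=> e23; have e1 : e \in edges1 E b x = false.
  by apply: contraTF e23 => /edges1N23 ->.
rewrite /sampled !in_setU e1 orFb (in_set_sep _ (edges2 E b x)).
rewrite (in_set_sep _ (edges3 E b x)).
move: e23; rewrite in_setU => /orP[e2|e3].
  rewrite e2 edges2N3 //= orbF; apply/existsPn/all_tailsP => h.
    case=> [[e' i]|e']; rewrite inE /= => /andP[he /eqP ee]; rewrite ee.
      exact: h.
    by move: he; rewrite ee edges2N3.
  by move=> i; apply: h; rewrite inE /= e2 eqxx.
have e2 : e \in edges2 E b x = false by apply: contraTF e3 => /edges2N3 ->.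
rewrite e2 e3 /=; apply/idP/all_tailsP => [h|]; last first.
  by apply; rewrite inE /= e3 eqxx.
case=> [[e' i]|e']; rewrite inE /= => /andP[he /eqP ee]; last by rewrite ee.
by move: he; rewrite ee e2.
Qed.

Lemma edges1_sub_sampled (w : {ffun coin V k -> bool}) :
  edges1 E b x \subset sampled E b x w.
Proof. by rewrite /sampled -setUA subsetUl. Qed.

Lemma sampled_sub (w : {ffun coin V k -> bool}) :
  sampled E b x w \subset support.
Proof.
rewrite -edges123E; apply: setUSS; last first.
  by apply/subsetP => e; rewrite in_set_sep => /andP[].
by apply: setUSS => //; apply/subsetP => e; rewrite in_set_sep => /andP[].
Qed.

Lemma card_sampled (w : {ffun coin V k -> bool}) :
  #|sampled E b x w|%:R +
    \sum_(e in edges23) ((all_tails (edge_coins e) w)%:R : R) = #|support|%:R.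
Proof.
have suppE : support = edges1 E b x :|: edges23 by rewrite setUA edges123E.
rewrite -(cardsID (sampled E b x w) support) (setIidPr (sampled_sub w)) natrD.
congr (_ + _); rewrite cardE_sum [LHS]big_mkcond [RHS]big_mkcond; apply: eq_bigr => e _.
rewrite suppE in_setD (in_setU e (edges1 E b x)).
have [e23|_] := boolP (e \in edges23).
  by rewrite orbT andbT notin_sampled //; case: all_tails.
rewrite orbF; case: (boolP (e \in edges1 E b x)) => [e1|]; rewrite ?andbF //.
by rewrite (subsetP (edges1_sub_sampled w)).
Qed.

Lemma skip_prob_sum :
  #|support|%:R - (1 - eps ^+ k) * (dlt * lp_value E x) <=
  \sum_(e in edges23) skip_prob e.
Proof.
have d2 := delta_ge2R.
apply: (@le_trans _ _ (\sum_(e in edges23) (1 - (1 - eps ^+ k) * dlt * x e))).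
  have suppE : support = edges1 E b x :|: edges23 by rewrite setUA edges123E.
  have h12 (f : {set V} -> R) : \sum_(e in support) f e =
      \sum_(e in edges1 E b x) f e + \sum_(e in edges23) f e.
    rewrite -bigU /=; first by apply: eq_bigl => e; rewrite suppE in_setU.
    rewrite disjoint_subset; apply/subsetP => e /edges1N23 e23.
    by rewrite inE e23.
  rewrite lp_value_support cardE_sum mulrA mulr_sumr -sumrB h12 gerDr.
  apply: sumr_le0 => e; rewrite inE => /andP[_].
  rewrite /lambda invf_div subr_le0 => h.
  have := delta_1Bepsk; rewrite [leRHS]mulrC => hd.
  have h1 : 1 <= (dlt + 1) / 2 * (2 / (dlt + 1)).
    by rewrite le_eqVlt; apply/orP; left; apply/eqP; field; lra.
  by apply: (le_trans h1); apply: ler_pM => //; rewrite divr_ge0 //; lra.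
by apply: ler_sum => e; apply: skip_prob_ge.
Qed.

Lemma skip_prob01 e : 0 <= skip_prob e <= 1.
Proof.
apply/andP; split; first by apply: prodr_ge0 => c _; have /andP[] := bias01 c; lra.
by apply: prodr_ile1 => c _; have /andP[] := bias01 c; lra.
Qed.

(** Different edges have disjoint sets of coins, so the mean is the product of the
    [1 - z * skip_prob e], to which [1 + t <= e^t] applies. *)
Lemma coins_mean_skips (z : R) : 0 <= z <= 1 ->
  coins_mean bias (fun w =>
    \prod_(e in edges23) (1 - z * (all_tails (edge_coins e) w)%:R)) <=
  expR (- (z * \sum_(e in edges23) skip_prob e)).
Proof.
move=> /andP[z0 z1].
have := coins_mean_prod_blocks bias coin_edge coin_active z (enum edges23) set0
  (enum_uniq _).
rewrite big_set0 mul1r => H; rewrite (eq_coins_mean _ _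
    (fun w => (all_tails set0 w)%:R * \prod_(e <- enum edges23)
       (1 - z * (all_tails (edge_coins e) w)%:R))); last first.
  move=> w; rewrite -big_enum /= (introT (all_tailsP _ _)) ?mul1r //.
  by move=> c; rewrite inE.
rewrite H; last by move=> c; rewrite inE.
rewrite big_enum mulr_sumr -sumrN expR_sum; apply: ler_prod => e _.
have /andP[t0 t1] := skip_prob01 e; rewrite -/(edge_coins e) -/(skip_prob e).
by apply/andP; split; [rewrite subr_ge0 mulr_ile1 | apply: expR_ge1Dx].
Qed.

Lemma uncovered_mean :
  coins_mean bias (fun w => #|uncovered (sampled E b x w)|%:R) <=
  #|V|%:R * expR (- (2 * a_param E b k eps)).
Proof.
rewrite (eq_coins_mean _ _
    (fun w => \sum_v (v \in uncovered (sampled E b x w))%:R)); last first.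
  by move=> w /=; rewrite cardE_sum big_mkcond; apply: eq_bigr => v _; case: (_ \in _).
rewrite coins_mean_sum mulr_natl -sumr_const; apply: ler_sum => v _.
pose Fv : {set coin V k} := [set c | coin_active c && (v \in coin_edge c)].
(* [edges1] lacks at most one edge at [v], so a single head on an edge through [v] covers it. *)
have unc_tails w : v \in uncovered (sampled E b x w) ->
    (#|[set e in edges1 E b x | v \in e]| + 1 <= b v)%N && all_tails Fv w.
  rewrite inE /fully_covered -ltnNge => cv; apply/andP; split.
    rewrite addn1; apply: leq_ltn_trans cv; apply/subset_leq_card/subsetP => e.
    rewrite in_set_sep => /andP[e1 ve].
    by rewrite in_set_sep ve (subsetP (edges1_sub_sampled w)).
  apply: contraTT cv => /forall_inPn [c]; rewrite inE negbK => /andP[ac vc] wc.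
  rewrite -leqNgt; apply: leq_trans (card_edges1_ge v) _.
  have c23 : coin_edge c \in edges23.
    by case: c ac {vc wc} => [[e i]|e] /= ac; rewrite in_setU ac ?orbT.
  have cs : coin_edge c \in sampled E b x w.
    apply: contraT; rewrite notin_sampled // => /all_tailsP /(_ c).
    by rewrite inE ac eqxx wc => /(_ isT).
  rewrite (cardsD1 (coin_edge c) [set e in sampled E b x w | _]) in_set_sep cs vc.
  rewrite addnC leq_add2l; apply/subset_leq_card/subsetP => e.
  rewrite in_set_sep => /andP[e1 ve]; rewrite in_setD1 in_set_sep ve.
  rewrite (subsetP (edges1_sub_sampled w)) // !andbT.
  by apply: contraTneq c23 => <-; rewrite edges1N23.
have [few|many] := leqP (#|[set e in edges1 E b x | v \in e]| + 1) (b v); last first.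
  rewrite (eq_coins_mean _ _ (fun=> 0 * 1)).
    by rewrite coins_meanZ mul0r expR_ge0.
  move=> w; rewrite mul0r; case: (boolP (v \in uncovered _)) => // /unc_tails.
  by rewrite leqNgt many.
apply: (@le_trans _ _ (coins_mean bias (fun w => (all_tails Fv w)%:R))).
  apply: le_coins_mean; first exact: bias01.
  by move=> w; case: (boolP (v \in uncovered _)) => // /unc_tails /andP[_ ->].
rewrite coins_mean_all_tails.
apply: (@le_trans _ _ (\prod_(c in Fv) expR (- bias c))).
  apply: ler_prod => c _; have /andP[b0 b1] := bias01 c.
  by rewrite subr_ge0 b1 expR_ge1Dx.
rewrite -expR_sum ler_expR sumrN lerN2.
rewrite (eq_bigl (fun c => coin_active c && (v \in coin_edge c))); last first.
  by move=> c; rewrite inE.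
rewrite (big_coins _ _ _ (fun e : {set V} => v \in e)) /=.
have d2 := delta_ge2R.
set X2 := \sum_(e in edges2 E b x | v \in e) x e.
set X3 := \sum_(e in edges3 E b x | v \in e) x e.
rewrite (eq_bigr (fun e => k%:R * lambda0 E b eps * x e)); last first.
  by move=> e /andP[e2 _]; rewrite e2 sumr_const card_ord -mulrA mulr_natl.
rewrite [X in _ + X](eq_bigr (fun e => (1 - eps ^+ k) * dlt * x e)); last first.
  by move=> e /andP[-> _].
rewrite -!mulr_sumr -/X2 -/X3.
(* [edges1] contributes at most [b v - 1] to the coverage of [v]. *)
have X23 : 1 <= X2 + X3.
  have [cov x01] := x_feasible; have := cov v.
  rewrite (sum_edges (fun e : {set V} => v \in e) x) // -/X2 -/X3.
  have : \sum_(e in edges1 E b x | v \in e) x e <=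
      #|[set e in edges1 E b x | v \in e]|%:R.
    rewrite cardsE_sum; apply: ler_sum => e /andP[]; rewrite inE => /andP[eE _] _.
    by have /andP[] := x01 e eE.
  move: few; rewrite -(ler_nat R) natrD; lra.
(* [edges1] falls short at [v] whereas [edges1] and [edges2] together do not, so some edge of
   [edges2] contains [v]. *)
have X2d : 1 <= dlt * X2.
  have : (0 < #|[set e in edges2 E b x | v \in e]|)%N.
    have := card_edges12_ge v.
    have : (#|[set e in edges1 E b x :|: edges2 E b x | v \in e]| <=
      #|[set e in edges1 E b x | v \in e]| + #|[set e in edges2 E b x | v \in e]|)%N.
      rewrite -cardsUI; apply: leq_trans (leq_addr _ _).
      apply/subset_leq_card/subsetP => e; rewrite in_set_sep => /andP[e12 ve].
      rewrite in_setU (in_set_sep _ (edges1 E b x)) (in_set_sep _ (edges2 E b x)).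
      by rewrite ve !andbT -in_setU.
    lia.
  move=> /card_gt0P[e]; rewrite in_set_sep => /andP[e2 ve].
  have xe : 1 <= dlt * x e.
    by move: e2; rewrite inE => /and3P[_ h _]; rewrite mulrC -ler_pdivrMr ?mul1r //; lra.
  apply: (le_trans xe); rewrite ler_wpM2l //.
  rewrite /X2 (bigD1 e) /= ?e2 // lerDl; apply: sumr_ge0 => e'.
  rewrite inE => /andP[/andP[/and3P[_ h _] _] _].
  by apply: le_trans h; rewrite invr_ge0; lra.
have bern := bernoulli_upper k eps eps_ge0 eps_le1.
have /andP[s0 s1] := epsk01.
rewrite /a_param /lambda0; set s := eps ^+ k in bern s0 s1 *.
(* The sum of the biases is [(1 - s) * dlt * (X2 + X3) + (k * (1 - eps) - (1 - s)) * dlt * X2]; with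
   [X23] and [X2d] it is at least [k * (1 - eps) + (dlt - 1) * (1 - s)], twice [a_param]. *)
have h1 : 0 <= (1 - s) * dlt * (X2 + X3 - 1).
  by apply: mulr_ge0; [apply: mulr_ge0; lra | lra].
have h2 : 0 <= (k%:R * (1 - eps) - (1 - s)) * (dlt * X2 - 1).
  by apply: mulr_ge0; lra.
lra.
Qed.

(** * Size of the output *)

Local Notation opt := (lp_value E x).
Local Notation s := (eps ^+ k).
Local Notation slack := ((1 - eps) * (s * (dlt * opt)) / 2).

Definition size_bound : R :=
  Num.max ((1 - (1 - eps) * eps ^+ k / 2) * dlt)
    ((1 - ((min_demand b)%:R - 1) * eps ^+ k / (18 * (max_edge_size E)%:R)
          * expR (a_param E b k eps)) * dlt) * lp_opt E b.

Lemma size_bound_ge1 : dlt * opt - slack <= size_bound.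
Proof.
rewrite /size_bound (lp_optE _ _ _ x_optimal).
apply: (@le_trans _ _ ((1 - (1 - eps) * eps ^+ k / 2) * dlt * opt)).
  by rewrite le_eqVlt; apply/orP; left; apply/eqP; field.
by rewrite ler_wpM2r ?le_max ?lexx // ltW // lp_value_gt0.
Qed.

Lemma size_bound_ge2 : dlt * opt - alpha E b k eps * opt / 3 <= size_bound.
Proof.
rewrite /size_bound (lp_optE _ _ _ x_optimal) /alpha.
have l0 : (max_edge_size E)%:R != 0 :> R.
  by rewrite pnatr_eq0 -lt0n max_edge_size_gt0.
set m := (max_edge_size E)%:R in l0 *; set g := expR _; set a1 := Num.max _ _.
have a1ge : (1 - ((min_demand b)%:R - 1) * eps ^+ k / (18 * m) * g) * dlt <= a1.
  by rewrite /a1 le_max lexx orbT.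
have := ler_wpM2r (ltW lp_value_gt0) a1ge; apply: le_trans.
by rewrite le_eqVlt; apply/orP; left; apply/eqP; field.
Qed.

(** Thus the first alternative of [support_excess] makes the gap exceed [slack]. The reason is
    [s * dlt <= (dlt - 1) / 2], from the bound on [eps ^+ k]. *)
Lemma slack_lt : slack < (dlt - 1) / 2 * opt.
Proof.
have d2 := delta_ge2R; have o0 := lp_value_gt0; have /andP[s0 s1] := epsk01.
have sd : s * dlt <= (dlt - 1) / 2.
  have -> : (dlt - 1) / 2 = (dlt - 1) / (2 * dlt) * dlt by field; lra.
  by rewrite ler_wpM2r //; lra.
have h1 : s * dlt * opt <= (dlt - 1) / 2 * opt by rewrite ler_wpM2r // ltW.
have h2 : 0 <= eps * (s * dlt * opt).
  by rewrite !mulr_ge0 ?eps_ge0 //; exact: ltW.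
have h3 : 0 < (dlt - 1) / 2 * opt by rewrite mulr_gt0 //; lra.
lra.
Qed.

Lemma edges12_size_bound : alpha E b k eps * opt <= #|edges1 E b x|%:R ->
  #|edges1 E b x :|: edges2 E b x|%:R < size_bound.
Proof.
have d2 := delta_ge2R => le_c.
case: support_excess => [ex|[[e eE xe] _]].
  apply: lt_le_trans size_bound_ge1; have := slack_lt.
  have : #|edges1 E b x :|: edges2 E b x|%:R <= #|support|%:R :> R.
    by rewrite ler_nat -edges123E; apply/subset_leq_card/subsetUl.
  lra.
apply: lt_le_trans size_bound_ge2; apply: (le_lt_trans edges12_size).
have := edges1_excess_strict _ eE xe.
(* The ratio is at least [1 / 3] because [dlt >= 2]; this accounts for 18 in the bound against 6 in
   [alpha]. *)
have : 1 / 3 * #|edges1 E b x|%:R <= (dlt - 1) / (dlt + 1) * #|edges1 E b x|%:R.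
  by rewrite ler_wpM2r // ler_pdivlMr; lra.
lra.
Qed.

Lemma repaired_sub_support (w : {ffun coin V k -> bool}) C :
  repaired E b x (sampled E b x w) C -> C \subset support.
Proof.
move=> /andP[+ _] => /(repair_cost _ _ (edges1_sub_sampled w)) [_ sub _].
apply: subset_trans sub _; rewrite subUset sampled_sub -edges123E.
by apply: subset_trans (subsetUl _ _); apply: subsetUr.
Qed.

Lemma output_multicover (w : {ffun coin V k -> bool}) C :
  output E b eps x w C -> set_multicover E b C.
Proof.
rewrite /output; case: ifP => _; first by move=> /eqP ->; exact: edges12_multicover.
apply: repaired_multicover; first exact: edges1_sub_sampled.
by apply: subset_trans (sampled_sub w) _; apply/subsetP => e; rewrite inE => /andP[].
Qed.

Lemma vertices_lt : #|edges1 E b x|%:R < alpha E b k eps * opt ->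
  6 * #|V|%:R < expR (a_param E b k eps) * (s * (dlt * opt)).
Proof.
move=> lt_c; have := vertices_le_edges1.
have l0 : 0 < (max_edge_size E)%:R :> R by rewrite ltr0n max_edge_size_gt0.
have b1 : 0 < (min_demand b)%:R - 1 :> R by rewrite subr_gt0 ltr1n min_demand_ge2.
have : (max_edge_size E)%:R * #|edges1 E b x|%:R <
    (max_edge_size E)%:R * (alpha E b k eps * opt) by rewrite ltr_pM2l.
rewrite /alpha; set g := expR _ => lt_lc /le_lt_trans /(_ lt_lc) h.
rewrite -(ltr_pM2r b1).
have : 6 * (#|V|%:R * ((min_demand b)%:R - 1)) <
  6 * ((max_edge_size E)%:R * (((min_demand b)%:R - 1) * dlt * s /
      (6 * (max_edge_size E)%:R) * g * opt)) by rewrite ltr_pM2l.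
rewrite mulrA => /lt_le_trans; apply; rewrite le_eqVlt; apply/orP; left.
by apply/eqP; field; apply: lt0r_neq0.
Qed.

Local Notation small_output w :=
  [forall C : {set {set V}}, output E b eps x w C ==> (#|C|%:R < size_bound)].

Lemma size_bound_certain :
  (forall (w : {ffun coin V k -> bool}) C,
     output E b eps x w C -> #|C|%:R < size_bound) ->
  coins_prob bias (fun w => small_output w) = 1.
Proof.
move=> small; rewrite coins_probE -[RHS](coins_mean1 bias); apply: eq_coins_mean => w.
by rewrite (introT forallP) // => C; apply/implyP/small.
Qed.

Lemma size_bound_likely : #|edges1 E b x|%:R < alpha E b k eps * opt ->
  dlt * opt - #|support|%:R <= slack ->
  65 / 100 < coins_prob bias (fun w => small_output w).
Proof.
move=> lt_c; set A := s * (dlt * opt); set Z := _ / 2.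
set D := _ - _ => DZ.
have o0 := lp_value_gt0; have d2 := delta_ge2R; have e0 := eps_gt0.
have s0 : 0 < s by rewrite exprn_gt0.
have A0 : 0 < A by rewrite !mulr_gt0 //; lra.
(* The first alternative of [support_excess] is incompatible with [DZ]. *)
have dD : dlt - 1 <= D.
  case: support_excess => [ex|[_ //]]; have := slack_lt; rewrite -/Z.
  by move: ex DZ; rewrite /D; lra.
have nA := vertices_lt lt_c; rewrite -/A in nA.
set a := a_param E b k eps in nA.
have d4 : (4 <= delta E b)%N.
  apply: (small_delta_excluded k _ eps #|V|%:R opt _ eps_le1 eps_ge epsk_le o0 _ nA).
    exact: delta_ge2.
  rewrite -[X in _ <= X / 2]mulrA -/A -/Z; apply: le_trans DZ.
  by have := support_size; rewrite /D; lra.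
have d4R : 4 <= dlt by rewrite (ler_nat R 4).
have ea : 34 / 10 + 8 / 100 <= expR a.
  apply: (le_trans expR_5_4_ge); rewrite ler_expR.
  exact: a_param_ge d4R eps_ge0 eps_le1 epsk_le.
(* With this [z], a factor [1 - (1 - z) * t] is [e^(-6/5)] for [t = 1] and 1 for [t = 0], so the
   product over the edges is an exponential of [U]. *)
pose z := expR (- (6 / 5)) : R.
have z01 : 0 <= 1 - z <= 1.
  by rewrite subr_ge0 /z expR_le1 lerBlDr lerDl expR_ge0 andbT; lra.
pose U (w : {ffun coin V k -> bool}) : R :=
  \sum_(e in edges23) (all_tails (edge_coins e) w)%:R.
have prodE w : \prod_(e in edges23) (1 - (1 - z) * (all_tails (edge_coins e) w)%:R)
    = expR (- (6 / 5) * U w).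
  rewrite mulr_sumr expR_sum; apply: eq_bigr => e _.
  by case: all_tails; rewrite ?mulr1 ?mulr0 ?expR0 ?subr0 //= opprB addrC subrK.
pose K := expR (6 / 5 * (Z - D + A / 5)).
pose unc (w : {ffun coin V k -> bool}) : R := #|uncovered (sampled E b x w)|%:R.
(* Markov and Chernoff in one pointwise bound: in a failure, either [unc w >= A / 5], or
   [U w <= Z - D + A / 5], and the corresponding term is at least 1. *)
have fail (w : {ffun coin V k -> bool}) : (~~ small_output w)%:R <=
    5 / A * unc w +
    K * \prod_(e in edges23) (1 - (1 - z) * (all_tails (edge_coins e) w)%:R).
  rewrite prodE; have t1 : 0 <= 5 / A * unc w.
    by rewrite mulr_ge0 // divr_ge0 // ltW.
  have t2 : 0 <= K * expR (- (6 / 5) * U w) by rewrite mulr_ge0 ?expR_ge0.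
  have [_|/forallPn [C]] := boolP (small_output w); first exact: addr_ge0.
  rewrite negb_imply -leNgt /output (lp_optE _ _ _ x_optimal).
  rewrite [alpha _ _ _ _ * _ <= _]leNgt lt_c /=.
  move=> /andP[/andP[conn _] large].
  have [_ _ cost] := repair_cost _ _ (edges1_sub_sampled w) conn.
  have costR : #|C|%:R <= #|sampled E b x w|%:R + unc w.
    by rewrite -natrD ler_nat.
  have := card_sampled w; rewrite -/(U w) => cs.
  have := size_bound_ge1; rewrite -/A -/Z => bd.
  have [big_unc|small_unc] := leP (A / 5) (unc w).
    suff : 1 <= 5 / A * unc w by lra.
    rewrite mulrAC ler_pdivlMr //; lra.
  suff : 1 <= K * expR (- (6 / 5) * U w) by lra.
  by rewrite -expRD -[leLHS]expR0 ler_expR; move: large; rewrite /D; lra.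
(* The two terms are at most 0.240 and 0.104. *)
have meanF : coins_mean bias (fun w => (~~ small_output w)%:R) < 35 / 100.
  apply: (@le_lt_trans _ _ (5 / A * (#|V|%:R * expR (- (2 * a))) +
      K * expR (- ((1 - z) * \sum_(e in edges23) skip_prob e)))).
    apply: le_trans (le_coins_mean _ bias01 _ _ fail) _.
    rewrite coins_meanD !coins_meanZ; apply: lerD.
      by rewrite ler_wpM2l ?divr_ge0 ?(ltW A0) // uncovered_mean.
    by rewrite ler_wpM2l ?expR_ge0 // coins_mean_skips.
  (* [nA] bounds this by [5 / 6 * e^(-a)], and [e^a >= 3.48] gives [e^(-a) <= 0.288]. *)
  have p1 : 5 / A * (#|V|%:R * expR (- (2 * a))) <= 240 / 1000.
    have ea0 := expR_gt0 a; have ena := expRxMexpNx_1 a; have ena0 := expR_gt0 (- a).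
    have -> : - (2 * a) = - a + - a by ring.
    rewrite expRD mulrAC ler_pdivrMr //.
    have h1 := ler_wpM2r (ltW ena0) (ltW nA).
    rewrite [leRHS]mulrAC ena mul1r in h1.
    have h2 : expR (- a) <= 288 / 1000 by nra.
    have h3 := ler_wpM2r (ltW ena0) h1.
    have h4 := ler_wpM2l (ltW A0) h2.
    lra.
  have p2 : K * expR (- ((1 - z) * \sum_(e in edges23) skip_prob e)) <= 104 / 1000.
    rewrite -expRD; apply: (@le_trans _ _ (expR (- (229 / 100)))).
      rewrite ler_expR.
      have := failure_bound dlt A Z D eps d4R eps_ge (ltW A0) erefl dD DZ.
      apply: le_trans; rewrite lerD2l lerN2; apply: ler_wpM2l; first by case/andP: z01.
      apply: le_trans skip_prob_sum; rewrite /D /A le_eqVlt.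
      by apply/orP; left; apply/eqP; ring.
    exact: expRN_229_100_le.
  lra.
have : coins_mean bias (fun w => (small_output w)%:R) +
    coins_mean bias (fun w => (~~ small_output w)%:R) = 1.
  rewrite -coins_meanD -[RHS](coins_mean1 bias); apply: eq_coins_mean => w.
  by case: (small_output w); rewrite /= ?addr0 ?add0r.
by rewrite coins_probE; lra.
Qed.

Lemma size_bound_prob : 65 / 100 < coins_prob bias (fun w => small_output w).
Proof.
have o := lp_optE _ _ _ x_optimal.
have [le_c|lt_c] := leP (alpha E b k eps * opt) #|edges1 E b x|%:R.
  rewrite size_bound_certain; first by lra.
  by move=> w C; rewrite /output o le_c => /eqP ->; apply: edges12_size_bound.
have [le_D|lt_D] := leP (dlt * opt - #|support|%:R) slack.
  exact: size_bound_likely.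
rewrite size_bound_certain; first by lra.
move=> w C; rewrite /output o leNgt lt_c /= => /repaired_sub_support /subset_leq_card.
rewrite -(ler_nat R) => le_C; apply: lt_le_trans size_bound_ge1; lra.
Qed.

End Fractional.

Theorem theorem5 (R : realType) (V : finType) (E : {set {set V}})
    (b : V -> nat) (k : nat) (eps : R) (x : {set V} -> R)
    (V_nonempty : (0 < #|V|)%N)
    (b_ge2 : forall v : V, (2 <= b v)%N)
    (b_le_degree : forall v : V, (b v <= degree E v - 1)%N)
    (k_ge2 : (2 <= k)%N)
    (eps_ge : ((delta E b)%:R - 1) / (2 * (delta E b)%:R) <= eps)
    (eps_le : eps <= (((delta E b)%:R - 1) / (2 * (delta E b)%:R)) `^ (k%:R^-1))
    (x_optimal : lp_optimal E b x) :
  (forall (w : {ffun coin V k -> bool}) (C : {set {set V}}),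
     output E b eps x w C -> set_multicover E b C) /\
  65 / 100 <
    coins_prob (coin_bias E b eps x)
      (fun w : {ffun coin V k -> bool} =>
         [forall C : {set {set V}}, output E b eps x w C ==>
            (#|C|%:R <
               Num.max
                 ((1 - (1 - eps) * eps ^+ k / 2) * (delta E b)%:R)
                 ((1 - ((min_demand b)%:R - 1) * eps ^+ k
                         / (18 * (max_edge_size E)%:R)
                         * expR (a_param E b k eps))
                  * (delta E b)%:R)
               * lp_opt E b)]).
Proof.
have x_feasible := proj1 x_optimal.
have d2 := @delta_ge2R R V E b V_nonempty b_ge2 b_le_degree.
have eps0 : 0 <= eps by apply: le_trans eps_ge; rewrite divr_ge0 //; lra.
have u0 : 0 <= ((delta E b)%:R - 1) / (2 * (delta E b)%:R) :> R.
  by rewrite divr_ge0 //; lra.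
(* The upper end of the range of [eps] enters as a bound on [eps ^+ k], which is below 1 and so also
   yields [eps <= 1]. *)
have epsk := root_bound k eps _ (ltnW k_ge2) eps0 u0 eps_le.
have eps1 : eps <= 1.
  rewrite -(expr_le1 (ltnW k_ge2) eps0); apply: (le_trans epsk).
  by rewrite ler_pdivrMr; lra.
split; first exact: output_multicover.
exact: (size_bound_prob _ _ _ V_nonempty b_ge2 b_le_degree x_feasible x_optimal).
Qed.
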